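(* Let $U_\alpha(\mathfrak{g})$ be the quantum (1+1) centrally extended Poincaré algebra generated by $M,P_0,P_1,K$ with coproducts $$\begin{aligned} \Delta(M)&=M\otimes1+e^{-\alpha P_1}\otimes M+(e^{-\alpha P_1}-1)\otimes P_0,\quad &\Delta(P_0)&=P_0\otimes1+1\otimes P_0,\\ \Delta(P_1)&=P_1\otimes1+1\otimes P_1,\quad &\Delta(K)&=K\otimes e^{\alpha P_1}+1\otimes K, \end{aligned}$$ and commutation relations $$\begin{gathered} [P_0,P_1]=[M,P_0]=[M,P_1]=0,\quad [K,P_0]=\frac{e^{\alpha P_1}-1}{\alpha},\quad [K,P_1]=(M+P_0)e^{\alpha P_1},\\ [K,M]=-\left(\frac{\cosh(\alpha P_1)-1}{\alpha}+\frac{\alpha}{2}(M+P_0)^2e^{\alpha P_1}\right). \end{gathered}$$ Let $X^{abcd}=M^aP_0^bP_1^cK^d$ be its ordered basis, $x_{abcd}$ the dual basis, and let $\theta=x_{1000}$, $a_0=x_{0100}$, $a_1=x_{0010}$, $\chi=x_{0001}$ be the quantum group coordinates dual to $M,P_0,P_1,K$. Then the Hopf algebra dual form (universal $T$-matrix) $T=\sum_{a,b,c,d}x_{abcd}\otimes X^{abcd}$ is $$T=e^{\theta\otimes M}\,e^{a_0\otimes P_0}\,e^{a_1\otimes P_1}\,e^{\chi\otimes K}.$$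
   Context: Everything is formal in $\alpha$: $H=U_\alpha(\mathfrak{g})$ is a topologically free $\mathbb{R}[[\alpha]]$-module with topological basis $X^{abcd}$, $a,b,c,d\in\mathbb{Z}_{\ge0}$. $H^*$ is the dual Hopf algebra, whose elements are (possibly infinite) combinations of the dual basis elements defined by $\langle x_{abcd},X^{ijkl}\rangle=\delta_a^i\delta_b^j\delta_c^k\delta_d^l$. The product of $H^*$ is dual to the coproduct of $H$: $\langle xy,X\rangle=\langle x\otimes y,\Delta(X)\rangle$; the coproduct of $H^*$ is dual to the product of $H$: $\langle\Delta(x),X\otimes Y\rangle=\langle x,XY\rangle$. The universal $T$-matrix is the canonical element $T=\sum_\mu x_\mu\otimes X^\mu$ of the (completed) tensor product $H^*\otimes H$. For $x\in H^*$, $X\in H$, $e^{x\otimes X}:=\sum_{n\ge0}\frac1{n!}x^n\otimes X^n$. *)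

(* Defs.v *)
From HB Require Import structures.
From mathcomp Require Import all_boot all_order all_algebra finmap.
From mathcomp Require Import boolp classical_sets reals.

Set Implicit Arguments.
Unset Strict Implicit.
Unset Printing Implicit Defensive.

Import GRing.Theory.
Local Open Scope ring_scope.

Record fps (R : Type) := Fps { fcoef : nat -> R }.

Section FpsRing.
Variable R : comNzRingType.
Implicit Types f g h : fps R.

HB.instance Definition _ := gen_eqMixin (fps R).
HB.instance Definition _ := gen_choiceMixin (fps R).

Lemma fpsP f g : (forall n, fcoef f n = fcoef g n) -> f = g.
Proof. by case: f g => [f] [g] /= fg; congr Fps; apply/funext. Qed.

Definition fps0 : fps R := Fps (fun=> 0).
Definition fps1 : fps R := Fps (fun n => (n == 0%N)%:R).
Definition fpsN f : fps R := Fps (fun n => - fcoef f n).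
Definition fpsD f g : fps R := Fps (fun n => fcoef f n + fcoef g n).
Definition fpsM f g : fps R :=
  Fps (fun n => \sum_(i < n.+1) fcoef f i * fcoef g (n - i)).

Fact fpsDA : associative fpsD.
Proof. by move=> f g h; apply: fpsP => n /=; rewrite addrA. Qed.
Fact fpsDC : commutative fpsD.
Proof. by move=> f g; apply: fpsP => n /=; rewrite addrC. Qed.
Fact fps0D : left_id fps0 fpsD.
Proof. by move=> f; apply: fpsP => n /=; rewrite add0r. Qed.
Fact fpsNK : left_inverse fps0 fpsN fpsD.
Proof. by move=> f; apply: fpsP => n /=; rewrite addNr. Qed.

HB.instance Definition _ := GRing.isZmodule.Build (fps R) fpsDA fpsDC fps0D fpsNK.

Let trunc N f : {poly R} := \poly_(i < N) fcoef f i.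

Let truncM N n f g :
  (n < N)%N -> (trunc N f * trunc N g)`_n = fcoef (fpsM f g) n.
Proof.
move=> nN; rewrite coefM /=; apply: eq_bigr => i _.
have iN : (i < N)%N by apply: leq_ltn_trans nN; rewrite -ltnS.
by rewrite !coef_poly iN (leq_ltn_trans (leq_subr _ _) nN).
Qed.

Fact fpsMC : commutative fpsM.
Proof.
move=> f g; apply: fpsP => n.
by rewrite -(truncM f g (ltnSn n)) -(truncM g f (ltnSn n)) mulrC.
Qed.

Fact fpsMA : associative fpsM.
Proof.
move=> f g h; apply: fpsP => n.
have -> : fcoef (fpsM f (fpsM g h)) n =
          (trunc n.+1 f * (trunc n.+1 g * trunc n.+1 h))`_n.
  rewrite [RHS]coefM /=; apply: eq_bigr => i _.
  by rewrite coef_poly ltn_ord truncM // ltnS leq_subr.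
rewrite mulrA coefM [RHS]/=; apply: eq_bigr => i _.
by rewrite truncM // coef_poly ltnS leq_subr.
Qed.

Fact fps1M : left_id fps1 fpsM.
Proof.
move=> f; apply: fpsP => n /=.
rewrite big_ord_recl /= mul1r subn0 big1 ?addr0 // => i _.
by rewrite /= mul0r.
Qed.

Fact fpsMDl : left_distributive fpsM fpsD.
Proof.
move=> f g h; apply: fpsP => n /=.
by rewrite -big_split /=; apply: eq_bigr => i _; rewrite mulrDl.
Qed.

Fact fps1_neq0 : fps1 != 0.
Proof.
apply/eqP => /(congr1 (fun f => fcoef f 0)) /= /eqP.
by rewrite oner_eq0.
Qed.

HB.instance Definition _ :=
  GRing.Zmodule_isComNzRing.Build (fps R) fpsMA fpsMC fps1M fpsMDl fps1_neq0.

Definition fpsC (c : R) : fps R := Fps (fun n => if n == 0%N then c else 0).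

Definition alpha : fps R := Fps (fun n => (n == 1%N)%:R).

Lemma fcoefB f g n : fcoef (f - g) n = fcoef f n - fcoef g n.
Proof. by []. Qed.

Lemma fcoef_alphaM f n :
  fcoef (alpha * f) n = if n is m.+1 then fcoef f m else 0.
Proof.
case: n => [|n]; rewrite /= ?big_ord_recl.
  by rewrite big_ord0 /= mul0r addr0.
rewrite /= mul0r add0r /bump /= subSS subn0 mul1r big1 ?addr0 // => i _.
by rewrite /= mul0r.
Qed.

Lemma fcoef_alphaXM f n k :
  fcoef (alpha ^+ n * f) k = if (k < n)%N then 0 else fcoef f (k - n).
Proof.
elim: n k => [|n IH] k; first by rewrite expr0 mul1r subn0.
by rewrite exprS -mulrA fcoef_alphaM; case: k => [|k] //; rewrite IH ltnS.
Qed.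

End FpsRing.

Arguments alpha {R}.

Section Adic.
Variable R : comNzRingType.
Implicit Type W : lmodType (fps R).

Definition adic_dvd W (n : nat) (w : W) : Prop :=
  exists v : W, w = alpha ^+ n *: v.

Definition adic_separated W : Prop :=
  forall w : W, (forall n, adic_dvd n w) -> w = 0.

Definition adic_complete W : Prop :=
  adic_separated W /\
  forall u : nat -> W, (forall n, adic_dvd n (u n.+1 - u n)) ->
    exists l : W, forall n, adic_dvd n (l - u n).

(* unordered summation, for the [alpha]-adic topology *)
Definition adic_sum W (J : choiceType) (f : J -> W) (w : W) : Prop :=
  forall n : nat, exists F0 : {fset J}, forall F : {fset J},
    (F0 `<=` F)%fset -> adic_dvd n (w - \sum_(j <- F) f j).

Definition adic_null (J : choiceType) (c : J -> fps R) : Prop :=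
  forall n : nat, exists F : {fset J}, forall j, j \notin F ->
    @adic_dvd (fps R)^o n (c j).

(* Every vector is, in a unique way, the sum of [c j *: e j] for a family of
   scalars [c] tending to 0.  In an [alpha]-adically complete module this says
   that the module is topologically free on [e]. *)
Definition topological_basis W (J : choiceType) (e : J -> W) : Prop :=
  forall w : W, exists! c : J -> fps R,
    adic_null c /\ adic_sum (fun j => c j *: e j) w.

Lemma adic_dvd0 W n : adic_dvd n (0 : W).
Proof. by exists 0; rewrite scaler0. Qed.

Lemma adic_dvd_linear W W' (f : {linear W -> W'}) n w :
  adic_dvd n w -> adic_dvd n (f w).
Proof. by case=> v ->; exists (f v); rewrite linearZ. Qed.

Lemma adic_dvdD W n (v w : W) : adic_dvd n v -> adic_dvd n w -> adic_dvd n (v + w).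
Proof. by move=> [v' ->] [w' ->]; exists (v' + w'); rewrite scalerDr. Qed.

Lemma adic_dvdN W n (w : W) : adic_dvd n w -> adic_dvd n (- w).
Proof. by move=> [w' ->]; exists (- w'); rewrite scalerN. Qed.

Lemma adic_dvdZ W n a (w : W) : adic_dvd n w -> adic_dvd n (a *: w).
Proof. by move=> [w' ->]; exists (a *: w'); rewrite !scalerA mulrC. Qed.

Lemma adic_dvd_sum W n (J : choiceType) (F : seq J) (P : pred J) (f : J -> W) :
  (forall j, P j -> adic_dvd n (f j)) -> adic_dvd n (\sum_(j <- F | P j) f j).
Proof.
move=> Pf; apply: (big_ind (@adic_dvd W n)) => //; first exact: adic_dvd0.
by move=> v w; exact: adic_dvdD.
Qed.

Lemma adic_dvd_le W m n (w : W) : (m <= n)%N -> adic_dvd n w -> adic_dvd m w.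
Proof.
move=> mn [v ->]; exists (alpha ^+ (n - m) *: v).
by rewrite scalerA -exprD subnKC.
Qed.

Lemma adic_sum_unique W (J : choiceType) (f : J -> W) (s s' : W) :
  adic_separated W -> adic_sum f s -> adic_sum f s' -> s = s'.
Proof.
move=> sep fs fs'; apply/eqP; rewrite -subr_eq0; apply/eqP/sep => n.
have [F1 F1P] := fs n; have [F2 F2P] := fs' n.
have := F2P _ (fsubsetUr F1 F2); have := F1P _ (fsubsetUl F1 F2).
set S := \sum_(_ <- _) _ => sS /adic_dvdN s'S.
by rewrite (_ : s - s' = (s - S) - (s' - S)); [exact: adic_dvdD|
  rewrite opprB addrA subrK].
Qed.

Lemma adic_null_summable W (J : choiceType) (c : J -> fps R) (e : J -> W) :
  adic_complete W -> adic_null c -> exists s, adic_sum (fun j => c j *: e j) s.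
Proof.
move=> [_ cW] /choice[F FP].
pose G n := (\bigcup_(i <- iota 0 n.+1) F i)%fset.
have ce n j : j \notin F n -> adic_dvd n (c j *: e j).
  by move=> /FP[d ->]; exists (d *: e j); rewrite scalerA.
have FG n : (F n `<=` G n)%fset.
  by apply: bigfcup_sup => //; rewrite mem_iota add0n ltnS leqnn.
have GG n : (G n `<=` G n.+1)%fset.
  by rewrite /G -[n.+2]addn1 iotaD big_cat /= fsubsetUl.
have dvdG n (E : {fset J}) : (G n `<=` E)%fset ->
    adic_dvd n (\sum_(j <- E) c j *: e j - \sum_(j <- G n) c j *: e j).
  move=> GE; rewrite (big_fsetID _ (mem (G n))) /=.
  have -> : [fset j in E | j \in G n]%fset = G n.
    apply/fsetP => j; rewrite !inE /= andbC.
    by case jG: (j \in G n) => //=; rewrite (fsubsetP GE).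
  rewrite addrAC subrr add0r big_seq; apply: adic_dvd_sum => j.
  by rewrite !inE /= => /andP[_]; move=> jG; apply: ce; apply: contra jG;
    exact/fsubsetP.
have [n|l lP] := cW (fun n => \sum_(j <- G n) c j *: e j).
  exact: dvdG.
exists l => n; exists (G n) => E GE.
rewrite (_ : _ - _ = (l - \sum_(j <- G n) c j *: e j)
   - (\sum_(j <- E) c j *: e j - \sum_(j <- G n) c j *: e j)).
  by apply: adic_dvdD; [exact: lP | exact/adic_dvdN/dvdG].
by rewrite opprB addrA subrK.
Qed.

Lemma fps_adic_dvdP n (f : (fps R)^o) :
  adic_dvd n f <-> forall k, (k < n)%N -> fcoef f k = 0.
Proof.
split=> [[g ->] k kn|f0]; first by rewrite fcoef_alphaXM kn.
exists (Fps (fun k => fcoef f (k + n))); apply: fpsP => k.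
by rewrite fcoef_alphaXM; case: ltnP => [/f0//|nk] /=; rewrite subnK.
Qed.

Lemma fps_adic_complete : adic_complete (fps R)^o.
Proof.
split=> [f f0|u u_cauchy].
  by apply: fpsP => k; have /fps_adic_dvdP -> := f0 k.+1.
have u_stable n k m : (k < n)%N -> fcoef (u (m + n)%N) k = fcoef (u n) k.
  move=> kn; elim: m => //= m IH; rewrite addSn -IH.
  have /fps_adic_dvdP/(_ k) := u_cauchy (m + n)%N.
  rewrite fcoefB => /(_ (leq_trans kn (leq_addl _ _)))/eqP.
  by rewrite subr_eq0 => /eqP.
exists (Fps (fun k => fcoef (u k.+1) k)) => n; apply/fps_adic_dvdP => k kn.
by rewrite fcoefB /= -(subnK kn) u_stable // subrr.
Qed.

End Adic.

Record calgType (R : comNzRingType) := CAlg {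
  calg_sort :> algType (fps R);
  calg_complete : adic_complete calg_sort
}.

Definition fps_calg (R : comNzRingType) : calgType R :=
  @CAlg R (fps R)^o (@fps_adic_complete R).

Definition bilinear_map (K : pzRingType) (U V W : lmodType K)
    (f : U -> V -> W) : Prop :=
  (forall v, linear (f ^~ v)) /\ (forall u, linear (f u)).

Definition trilinear_map (K : pzRingType) (U V W Z : lmodType K)
    (f : U -> V -> W -> Z) : Prop :=
  (forall v w, linear (fun u => f u v w)) /\ (forall u, bilinear_map (f u)).

(* The completed tensor product of two algebras, given by its universal
   property among complete modules. *)
Record ctensor (R : comNzRingType) (A B : calgType R) := CTensor {
  ct_alg :> calgType R;
  ct_pure : A -> B -> ct_alg;
  ct_bilinear : bilinear_map ct_pure;
  ct_one : ct_pure 1 1 = 1;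
  ct_mul : forall a a' b b',
    ct_pure a b * ct_pure a' b' = ct_pure (a * a') (b * b');
  ct_lift : forall (W : lmodType (fps R)) (f : A -> B -> W),
    adic_complete W -> bilinear_map f ->
    exists g : {linear ct_alg -> W}, forall a b, g (ct_pure a b) = f a b;
  ct_lift_unique : forall (W : lmodType (fps R)) (g g' : {linear ct_alg -> W}),
    adic_complete W ->
    (forall a b, g (ct_pure a b) = g' (ct_pure a b)) -> g =1 g'
}.

(* The linear map induced on the completed tensor product by the bilinear map
   [f]; it is 0 if there is none. *)
Definition lift (R : comNzRingType) (A B : calgType R) (T : ctensor A B)
    (W : lmodType (fps R)) (f : A -> B -> W) : {linear T -> W} :=
  match pselect (exists g : {linear T -> W},
                   forall a b, g (ct_pure T a b) = f a b) with
  | left ex => projT1 (cid ex)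
  | right _ => \0
  end.

Lemma lift_pure (R : comNzRingType) (A B : calgType R) (T : ctensor A B)
    (W : lmodType (fps R)) (f : A -> B -> W) :
  adic_complete W -> bilinear_map f ->
  forall a b, lift T f (ct_pure T a b) = f a b.
Proof.
move=> cW bf; rewrite /lift; case: pselect => [ex|[]]; last exact: ct_lift.
by case: (cid ex).
Qed.

Lemma lift_uniq (R : comNzRingType) (A B : calgType R) (T : ctensor A B)
    (W : lmodType (fps R)) (f : A -> B -> W) (g : T -> W) :
  adic_complete W -> bilinear_map f -> linear g ->
  (forall a b, g (ct_pure T a b) = f a b) -> lift T f =1 g.
Proof.
move=> cW bf lg gE.
pose gl : {linear T -> W} := HB.pack g (GRing.isLinear.Build _ _ _ _ g lg).
apply: (@ct_lift_unique _ _ _ _ _ (lift T f) gl) => // a b.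
by rewrite lift_pure //= gE.
Qed.

(* [Delta] is automatically continuous, being [R[[alpha]]]-linear.
   [hopf_coassoc] says that [(Delta \otimes id) \o Delta] and
   [(id \otimes Delta) \o Delta] agree against every trilinear map, that is, in
   the completed threefold tensor product. *)
Record hopfType (R : comNzRingType) := Hopf {
  hopf_alg :> calgType R;
  hopf_tensor : ctensor hopf_alg hopf_alg;
  Delta : {lrmorphism hopf_alg -> hopf_tensor};
  counit : {lrmorphism hopf_alg -> (fps R)^o};
  antipode : {linear hopf_alg -> hopf_alg};
  hopf_coassoc : forall (W : lmodType (fps R))
      (t : hopf_alg -> hopf_alg -> hopf_alg -> W),
    adic_complete W -> trilinear_map t -> forall h,
    lift hopf_tensor
      (fun X Z => lift hopf_tensor (fun X1 X2 => t X1 X2 Z) (Delta X)) (Delta h)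
    = lift hopf_tensor
      (fun X Z => lift hopf_tensor (t X) (Delta Z)) (Delta h);
  hopf_counitl : forall h : hopf_alg,
    lift hopf_tensor (fun X Y => counit X *: Y) (Delta h) = h;
  hopf_counitr : forall h : hopf_alg,
    lift hopf_tensor (fun X Y => counit Y *: X) (Delta h) = h;
  hopf_antipodel : forall h : hopf_alg,
    lift hopf_tensor (fun X Y => antipode X * Y) (Delta h) = counit h *: 1;
  hopf_antipoder : forall h : hopf_alg,
    lift hopf_tensor (fun X Y => X * antipode Y) (Delta h) = counit h *: 1
}.

Arguments Delta {R _}.
Arguments counit {R _}.

Definition tens (R : comNzRingType) (H : hopfType R) (X Y : H) :
  hopf_tensor H := ct_pure (hopf_tensor H) X Y.

(* [conv H A] is the algebra of linear maps from the Hopf algebra [H] to the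
   complete algebra [A], with product dual to the coproduct of [H]:
   [(f * g) h = (mult \o (f \otimes g)) (Delta h)]. *)
Record conv (R : comNzRingType) (H : hopfType R) (A : calgType R) := Conv {
  conv_fun :> H -> A;
  conv_linear : linear conv_fun
}.

Section ConvRing.
Variables (R : comNzRingType) (H : hopfType R) (A : calgType R).
Implicit Types f g : conv H A.

HB.instance Definition _ f :=
  GRing.isLinear.Build _ _ _ _ (conv_fun f) (conv_linear f).
HB.instance Definition _ := gen_eqMixin (conv H A).
HB.instance Definition _ := gen_choiceMixin (conv H A).

Lemma convP f g : f =1 g -> f = g.
Proof.
case: f g => [f lf] [g lg] /= /funext fg; rewrite {}fg in lf *.
by congr Conv; apply: Prop_irrelevance.
Qed.

Fact conv0_linear : linear ((fun=> 0) : H -> A).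
Proof. by move=> a u v; rewrite scaler0 addr0. Qed.
Fact convN_linear f : linear (fun h => - f h).
Proof. by move=> a u v; rewrite linearP opprD scalerN. Qed.
Fact convD_linear f g : linear (fun h => f h + g h).
Proof. by move=> a u v; rewrite !linearP scalerDr addrACA. Qed.
Fact convZ_linear (c : fps R) f : linear (fun h => c *: f h).
Proof. by move=> a u v; rewrite linearP scalerDr !scalerA mulrC. Qed.
Fact conv1_linear : linear (fun h : H => counit h *: (1 : A)).
Proof.
move=> a u v.
by rewrite linearP scalerDl -[a *: counit u]/(a * counit u) -scalerA.
Qed.

Definition conv0 : conv H A := Conv conv0_linear.
Definition conv1 : conv H A := Conv conv1_linear.
Definition convN f : conv H A := Conv (convN_linear f).
Definition convD f g : conv H A := Conv (convD_linear f g).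
Definition convZ c f : conv H A := Conv (convZ_linear c f).

Lemma conv_bilinear f g : bilinear_map (fun X Y => f X * g Y).
Proof.
by split=> X a u v /=; rewrite linearP ?mulrDl ?mulrDr -?scalerAl -?scalerAr.
Qed.

Fact convM_linear f g :
  linear (fun h => lift (hopf_tensor H) (fun X Y => f X * g Y) (Delta h)).
Proof. by move=> a u v; rewrite !linearP. Qed.
Definition convM f g : conv H A := Conv (convM_linear f g).

Fact convDA : associative convD.
Proof. by move=> f g h; apply: convP => x /=; rewrite addrA. Qed.
Fact convDC : commutative convD.
Proof. by move=> f g; apply: convP => x /=; rewrite addrC. Qed.
Fact conv0D : left_id conv0 convD.
Proof. by move=> f; apply: convP => x /=; rewrite add0r. Qed.
Fact convNK : left_inverse conv0 convN convD.
Proof. by move=> f; apply: convP => x /=; rewrite addNr. Qed.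

HB.instance Definition _ :=
  GRing.isZmodule.Build (conv H A) convDA convDC conv0D convNK.

Fact convMA : associative convM.
Proof.
move=> f g h; apply: convP => x /=.
pose t X Y Z := f X * (g Y * h Z).
have tt : trilinear_map t.
  split=> [Y Z a u v|X]; first by rewrite /t linearP mulrDl scalerAl.
  split=> [Z a u v|Y a u v]; rewrite /t linearP.
    by rewrite mulrDl mulrDr -scalerAl -scalerAr.
  by rewrite !mulrDr -!scalerAr.
have cA := calg_complete A.
have /esym E := hopf_coassoc cA tt x.
transitivity (lift (hopf_tensor H)
    (fun X Z => lift (hopf_tensor H) (t X) (Delta Z)) (Delta x)).
  congr (GRing.Linear.sort (lift _ _) _); apply/funext => X; apply/funext => Y.
  rewrite -(@lift_uniq _ _ _ (hopf_tensor H) A (t X)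
    (fun z => f X * lift (hopf_tensor H) (fun U V => g U * h V) z)) //.
  - exact: (tt.2 X).
  - by move=> a u v; rewrite linearP mulrDr scalerAr.
  - by move=> a b; rewrite lift_pure //; exact: conv_bilinear.
rewrite E; congr (GRing.Linear.sort (lift _ _) _).
apply/funext => X; apply/funext => Y.
rewrite -(@lift_uniq _ _ _ (hopf_tensor H) A (fun U V => t U V Y)
  (fun z => lift (hopf_tensor H) (fun U V => f U * g V) z * h Y)) //.
- split=> [V|U]; first exact: (tt.1 V Y).
  exact: ((tt.2 U).1 Y).
- by move=> a u v; rewrite linearP mulrDl scalerAl.
- move=> a b; rewrite lift_pure // /t ?mulrA //; exact: conv_bilinear.
Qed.

Fact conv1M : left_id conv1 convM.
Proof.
move=> f; apply: convP => x /=.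
rewrite -[in RHS](hopf_counitl x).
apply: (@lift_uniq _ _ _ (hopf_tensor H) A (fun X Y => conv1 X * f Y)
  (fun z => f (lift _ (fun X Y => counit X *: Y) z))).
- exact: calg_complete.
- exact: (conv_bilinear conv1 f).
- by move=> a u v; rewrite !linearP.
- move=> a b; rewrite lift_pure ?linearZ //= ?mulr_algl //.
    exact: calg_complete.
  split=> X c u v; last by rewrite scalerDr !scalerA mulrC.
  by rewrite linearP scalerDl -[c *: counit u]/(c * counit u) -scalerA.
Qed.

Fact convM1 : right_id conv1 convM.
Proof.
move=> f; apply: convP => x /=.
rewrite -[in RHS](hopf_counitr x).
apply: (@lift_uniq _ _ _ (hopf_tensor H) A (fun X Y => f X * conv1 Y)
  (fun z => f (lift _ (fun X Y => counit Y *: X) z))).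
- exact: calg_complete.
- exact: (conv_bilinear f conv1).
- by move=> a u v; rewrite !linearP.
- move=> a b; rewrite lift_pure ?linearZ //= ?mulr_algr //.
    exact: calg_complete.
  split=> X c u v; first by rewrite scalerDr !scalerA mulrC.
  by rewrite linearP scalerDl -[c *: counit u]/(c * counit u) -scalerA.
Qed.

Fact convMDl : left_distributive convM convD.
Proof.
move=> f g h; apply: convP => x /=.
apply: (@lift_uniq _ _ _ (hopf_tensor H) A (fun X Y => (f X + g X) * h Y)
  (fun z => lift _ (fun X Y => f X * h Y) z + lift _ (fun X Y => g X * h Y) z)).
- exact: calg_complete.
- exact: (conv_bilinear (convD f g) h).
- by move=> a u v; rewrite !linearP scalerDr addrACA.
- by move=> a b; rewrite !lift_pure ?mulrDl //;
    first [exact: calg_complete | exact: conv_bilinear].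
Qed.

Fact convMDr : right_distributive convM convD.
Proof.
move=> f g h; apply: convP => x /=.
apply: (@lift_uniq _ _ _ (hopf_tensor H) A (fun X Y => f X * (g Y + h Y))
  (fun z => lift _ (fun X Y => f X * g Y) z + lift _ (fun X Y => f X * h Y) z)).
- exact: calg_complete.
- exact: (conv_bilinear f (convD g h)).
- by move=> a u v; rewrite !linearP scalerDr addrACA.
- by move=> a b; rewrite !lift_pure ?mulrDr //;
    first [exact: calg_complete | exact: conv_bilinear].
Qed.

Fact conv1_neq0 : conv1 != 0.
Proof.
apply/eqP => /(congr1 (fun f : conv H A => f 1)) /=.
by rewrite rmorph1 scale1r => /eqP; rewrite oner_eq0.
Qed.

HB.instance Definition _ := GRing.Zmodule_isNzRing.Build (conv H A)
  convMA conv1M convM1 convMDl convMDr conv1_neq0.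

Fact convZA a b f : convZ a (convZ b f) = convZ (a * b) f.
Proof. by apply: convP => x /=; rewrite scalerA. Qed.
Fact conv1Z : left_id 1 convZ.
Proof. by move=> f; apply: convP => x /=; rewrite scale1r. Qed.
Fact convZDr : right_distributive convZ +%R.
Proof. by move=> c f g; apply: convP => x /=; rewrite scalerDr. Qed.
Fact convZDl f : {morph convZ^~ f : a b / a + b}.
Proof. by move=> a b; apply: convP => x /=; rewrite scalerDl. Qed.

HB.instance Definition _ := GRing.Zmodule_isLmodule.Build (fps R) (conv H A)
  convZA conv1Z convZDr convZDl.

Lemma convME f g h :
  (f * g) h = lift (hopf_tensor H) (fun X Y => f X * g Y) (Delta h).
Proof. by []. Qed.

End ConvRing.

Notation dual H := (conv H (fps_calg _)).

(* [H^*] carries the weak topology (its elements are infinite combinations of a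
   dual basis).  The completed tensor product of [H^*] and [H] is then the space
   of linear endomorphisms of [H] with the topology of pointwise [alpha]-adic
   convergence, where [x \otimes X] is [h |-> <x, h> X]: see [dhpureM] for the
   product, and [dh_expansion] and [dh_exists] for the fact that its elements
   are exactly the sums of [x_j \otimes h_j] for arbitrary families [h_j]. *)
Notation dual_tensor H := (conv H (hopf_alg H)).

Section DualTensor.
Variables (R : comNzRingType) (H : hopfType R).

Fact dhpure_linear (x : dual H) (X : H) : linear (fun h => (x h : fps R) *: X).
Proof.
move=> a u v; rewrite linearP scalerDl; congr (_ + _).
exact: esym (scalerA a (x u : fps R) X).
Qed.

Definition dhpure (x : dual H) (X : H) : dual_tensor H :=
  Conv (dhpure_linear x X).

Definition dh_sum (J : choiceType) (t : J -> dual_tensor H)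
    (s : dual_tensor H) : Prop :=
  forall h : H, adic_sum (fun j => t j h) (s h).

Definition dh_summable (J : choiceType) (t : J -> dual_tensor H) : Prop :=
  exists s, dh_sum t s.

(* 0 if [t] is not summable *)
Definition dh_series (J : choiceType) (t : J -> dual_tensor H) :
    dual_tensor H :=
  xget 0 [set s | dh_sum t s]%classic.

Lemma dhpureM (x y : dual H) (X Y : H) :
  dhpure x X * dhpure y Y = dhpure (x * y) (X * Y).
Proof.
apply: convP => h; rewrite convME.
apply: (@lift_uniq _ _ _ (hopf_tensor H) H (fun A B => dhpure x X A * dhpure y Y B)
  (fun z => (lift _ (fun A B => x A * y B) z : fps R) *: (X * Y))).
- exact: calg_complete.
- exact: (conv_bilinear (dhpure x X) (dhpure y Y)).
- move=> a u v; rewrite linearP scalerDl; congr (_ + _).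
  by rewrite scalerA.
- move=> a b; rewrite (@lift_pure _ _ _ _ (fps R)^o).
  + by rewrite -scalerAl -scalerAr scalerA.
  + exact: fps_adic_complete.
  + exact: (conv_bilinear x y).
Qed.

Lemma adic_sum_linear (W W' : lmodType (fps R)) (f : {linear W -> W'})
    (J : choiceType) (w : J -> W) (s : W) :
  adic_sum w s -> adic_sum (fun j => f (w j)) (f s).
Proof.
move=> ws n; have [F0 F0P] := ws n; exists F0 => F /F0P.
by move=> /(adic_dvd_linear f); rewrite linearB linear_sum.
Qed.

Section DualBasis.
Variables (J : choiceType) (e : J -> H) (x : J -> dual H).
Hypothesis e_basis : topological_basis e.
Hypothesis x_dual : forall i j, x i (e j) = (i == j)%:R.

Lemma dual_basis_coord (c : J -> fps R) h j :
  adic_sum (fun i => c i *: e i) h -> x j h = c j.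
Proof.
move=> /(@adic_sum_linear _ (fps_calg R) (x j)) cs; apply/eqP.
rewrite -subr_eq0; apply/eqP; apply: (calg_complete (fps_calg R)).1 => n.
have [F0 F0P] := cs n.
have jF : j \in (j |` F0)%fset by rewrite !inE eqxx.
have := F0P _ (fsubsetU1 j F0).
rewrite (big_fsetD1 j) //= linearZ /= x_dual eqxx big1_fset ?addr0.
  by rewrite -[c j *: _]/(c j * 1) mulr1.
move=> i; rewrite !inE => /andP[/negbTE ij _] _.
by rewrite linearZ /= x_dual eq_sym ij scaler0.
Qed.

Lemma dh_expansion (t : dual_tensor H) :
  dh_sum (fun j => dhpure (x j) (t (e j))) t.
Proof.
move=> h; have [c [[_ ch] _]] := e_basis h.
move: (ch) => /(adic_sum_linear t) ts n.
have [F0 F0P] := ts n; exists F0 => F /F0P.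
congr (adic_dvd _ (_ - _)); apply: eq_bigr => j _ /=.
by rewrite (dual_basis_coord j ch) linearZ.
Qed.

Lemma dh_exists (k : J -> H) :
  exists t : dual_tensor H,
    dh_sum (fun j => dhpure (x j) (k j)) t /\ forall j, t (e j) = k j.
Proof.
have ks h : exists s, adic_sum (fun j => (x j h : fps R) *: k j) s.
  have [c [[c0 ch] _]] := e_basis h.
  have xc : (fun j => x j h : fps R) = c.
    by apply/funext => j; rewrite (dual_basis_coord j ch).
  have [s sP] := adic_null_summable k (calg_complete H) c0.
  by exists s; move: sP; rewrite -xc.
pose t h := projT1 (cid (ks h)).
have tP h : adic_sum (fun j => (x j h : fps R) *: k j) (t h).
  by rewrite /t; case: cid.
have sepH : adic_separated H := (calg_complete H).1.
have lt : linear t.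
  move=> a u v; apply: (adic_sum_unique sepH (tP _)) => n.
  have [F1 F1P] := tP u n; have [F2 F2P] := tP v n.
  exists (F1 `|` F2)%fset => F /fsubUsetP[/F1P ? /F2P ?].
  rewrite (_ : _ - _ = a *: (t u - \sum_(j <- F) (x j u : fps R) *: k j)
      + (t v - \sum_(j <- F) (x j v : fps R) *: k j)).
    by apply: adic_dvdD => //; apply: adic_dvdZ.
  rewrite scalerBr addrACA -opprD; congr (_ - _).
  rewrite scaler_sumr -big_split /=; apply: eq_bigr => j _.
  by rewrite linearP scalerDl scalerA.
exists (Conv lt); split=> [|j] /=; first exact: tP.
apply: (adic_sum_unique sepH (tP _)) => n.
exists [fset j]%fset => F; rewrite fsub1set => jF.
rewrite (big_fsetD1 j) //= x_dual eqxx scale1r big1_fset ?addr0 ?subrr.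
  exact: adic_dvd0.
move=> i; rewrite !inE => /andP[/negbTE ij _] _.
by rewrite x_dual ij scale0r.
Qed.

End DualBasis.
End DualTensor.

Section Exponentials.
Variables (R : realType) (H : hopfType R).

Definition invfact (n : nat) : fps R := fpsC (n`!%:R^-1).

(* The two operations below return 0 outside of their natural domain: [hexp h]
   is meant for [h] divisible by [alpha], when the series converges, and
   [divalpha h] for [h] divisible by [alpha], when the quotient is unique as
   soon as [H] is torsion-free. *)
Definition hexp (h : H) : H :=
  xget 0 [set s | adic_sum (fun n : nat => invfact n *: h ^+ n) s]%classic.

Definition divalpha (h : H) : H := xget 0 [set y | alpha *: y = h]%classic.

Definition hcosh (h : H) : H := fpsC 2^-1 *: (hexp h + hexp (- h)).

Definition commutator (X Y : H) : H := X * Y - Y * X.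

Definition ordered_monomial (M P0 P1 K : H) (mu : nat * nat * nat * nat) : H :=
  let '(a, b, c, d) := mu in M ^+ a * P0 ^+ b * P1 ^+ c * K ^+ d.

Definition dexp_term (x : dual H) (X : H) (n : nat) : dual_tensor H :=
  invfact n *: dhpure (x ^+ n) (X ^+ n).

Definition dexp (x : dual H) (X : H) : dual_tensor H :=
  dh_series (dexp_term x X).

Definition universal_T (J : choiceType) (x : J -> dual H) (e : J -> H) :
    dual_tensor H :=
  dh_series (fun j => dhpure (x j) (e j)).

End Exponentials.

(* Main.v *)
Require Import Defs.
From HB Require Import structures.
From mathcomp Require Import all_boot all_order all_algebra finmap.
From mathcomp Require Import boolp classical_sets reals.

Set Implicit Arguments.
Unset Strict Implicit.
Unset Printing Implicit Defensive.

Import GRing.Theory.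
Local Open Scope ring_scope.

(* In [conv U U] the universal T-matrix is the identity map of [U].  For a
   linear map [f] on [U] put [a.f = f (a _)].  The coproducts turn into Leibniz
   rules for [a.(f * g)], [a] a generator, whose twisting factors
   [exp (- alpha P1)], [exp (alpha P1)] disappear as soon as [P1.f = 0].

   For the coordinate [f] dual to a generator [X], these rules make [X] act on
   the powers of [f] as a derivation with [X.f = 1] (for [X = K], using the
   commutation relations), while the other generators kill them; hence
   [f^n / n!] is dual to [X^n], and [exp (f \otimes X)] sends [X^n] to itself
   and all other basis monomials to 0.  The same rules, applied to maps with
   values in [U], evaluate the product of the four exponentials on a basis
   monomial one factor at a time, and give back this monomial. *)

(** * Translations of linear maps and Leibniz rules for the convolution product *)

Section Translations.
Variables (R : comNzRingType) (H : hopfType R) (A : calgType R).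
Implicit Types (a b : H) (f g : conv H A).

Fact ltrans_linear a f : linear (fun h => f (a * h)).
Proof. by move=> c u v; rewrite mulrDr -scalerAr linearP. Qed.

Fact rtrans_linear a f : linear (fun h => f (h * a)).
Proof. by move=> c u v; rewrite mulrDl -scalerAl linearP. Qed.

Definition ltrans a f : conv H A := Conv (ltrans_linear a f).
Definition rtrans a f : conv H A := Conv (rtrans_linear a f).

Lemma ltransE a f h : ltrans a f h = f (a * h). Proof. by []. Qed.

Lemma ltrans1 f : ltrans 1 f = f.
Proof. by apply: convP => h /=; rewrite mul1r. Qed.

Lemma rtrans1 f : rtrans 1 f = f.
Proof. by apply: convP => h /=; rewrite mulr1. Qed.

Lemma ltransM a b f : ltrans (a * b) f = ltrans b (ltrans a f).
Proof. by apply: convP => h /=; rewrite mulrA. Qed.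

Lemma ltransD a b f : ltrans (a + b) f = ltrans a f + ltrans b f.
Proof. by apply: convP => h /=; rewrite mulrDl linearD. Qed.

Lemma ltransN a f : ltrans (- a) f = - ltrans a f.
Proof. by apply: convP => h /=; rewrite mulNr linearN. Qed.

Lemma ltransZ c a f : ltrans (c *: a) f = c *: ltrans a f.
Proof. by apply: convP => h /=; rewrite -scalerAl linearZ. Qed.

Lemma ltrans0_r a : ltrans a 0 = 0 :> conv H A.
Proof. exact: convP. Qed.

Lemma ltrans_comm0 a b f :
  a * b = b * a -> ltrans a f = 0 -> ltrans a (ltrans b f) = 0.
Proof. by move=> ab a0; rewrite -ltransM -ab ltransM a0 ltrans0_r. Qed.

Lemma ltrans_rtrans a b f : ltrans a (rtrans b f) = rtrans b (ltrans a f).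
Proof. by apply: convP => h /=; rewrite mulrA. Qed.

(** Both sides are linear in [z] and agree on pure tensors. Through this identity a formula for
    [Delta a] becomes a rule for [ltrans a (f * g)]. *)
Lemma lift_tensMl a b f g z :
  Defs.lift (hopf_tensor H) (fun X Y => f X * g Y) (tens a b * z) =
  Defs.lift (hopf_tensor H) (fun X Y => ltrans a f X * ltrans b g Y) z.
Proof.
apply/esym; move: z; apply: lift_uniq.
- exact: calg_complete.
- exact: conv_bilinear.
- by move=> c u v; rewrite mulrDr -scalerAr linearP.
- move=> X Y; rewrite /tens ct_mul lift_pure //; first exact: calg_complete.
  exact: conv_bilinear.
Qed.

Lemma lift_tensMr a b f g z :
  Defs.lift (hopf_tensor H) (fun X Y => f X * g Y) (z * tens a b) =
  Defs.lift (hopf_tensor H) (fun X Y => rtrans a f X * rtrans b g Y) z.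
Proof.
apply/esym; move: z; apply: lift_uniq.
- exact: calg_complete.
- exact: conv_bilinear.
- by move=> c u v; rewrite mulrDl -scalerAl linearP.
- move=> X Y; rewrite /tens ct_mul lift_pure //; first exact: calg_complete.
  exact: conv_bilinear.
Qed.

Lemma convM_one f g : (f * g) 1 = f 1 * g 1.
Proof.
rewrite convME rmorph1 -ct_one lift_pure //; first exact: calg_complete.
exact: conv_bilinear.
Qed.

Lemma ltrans_primitiveM a f g : Delta a = tens a 1 + tens 1 a ->
  ltrans a (f * g) = ltrans a f * g + f * ltrans a g.
Proof.
move=> Da; apply: convP => h.
rewrite ltransE convME rmorphM /= Da mulrDl linearD /=.
by rewrite !lift_tensMl !ltrans1.
Qed.

(** Linear maps over [fps R] preserve [alpha]-adic sums, and sums in [A] are unique because [A] is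
    separated. *)
Lemma conv_ext (J : choiceType) (e : J -> H) f g :
  topological_basis e -> (forall j, f (e j) = g (e j)) -> f = g.
Proof.
move=> eb fg; apply: convP => h; have [c [[_ ch] _]] := eb h.
apply: (adic_sum_unique (calg_complete A).1 (adic_sum_linear f ch)).
have <- : (fun j => g (c j *: e j)) = (fun j => f (c j *: e j)).
  by apply/funext => j; rewrite !linearZ /= fg.
exact: adic_sum_linear.
Qed.

(** The Leibniz rule is only asked for products [f * f ^+ m], since for [K] it is available only
    when the right factor is killed by [P1]. *)
Lemma ltrans_exp_leibniz a f n : ltrans a f = 1 -> ltrans a 1 = 0 :> conv H A ->
  (forall m, ltrans a (f * f ^+ m) = ltrans a f * f ^+ m + f * ltrans a (f ^+ m)) ->
  ltrans a (f ^+ n) = f ^+ n.-1 *+ n.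
Proof.
move=> af a1 leib; elim: n => [|n IH]; first by rewrite expr0 a1.
rewrite exprS leib af IH mul1r /=; case: n {IH} => [|n].
  by rewrite mulr0 addr0.
by rewrite mulrnAr -exprS -mulrS.
Qed.

Lemma conv_mulrn f n h : (f *+ n) h = f h *+ n.
Proof. by elim: n => // n IH; rewrite !mulrS -IH. Qed.

(** Each factor [a] stripped off differentiates the power of [f] once. The factorial survives only
    if both exponents reach 0 together, because [a] kills 1 and evaluation at 1 is multiplicative
    with [f 1 = 0]. *)
Lemma conv_exp_dual a f n i : ltrans a f = 1 -> ltrans a 1 = 0 :> conv H A ->
  f 1 = 0 ->
  (forall m, ltrans a (f * f ^+ m) = ltrans a f * f ^+ m + f * ltrans a (f ^+ m)) ->
  (f ^+ n) (a ^+ i) = (n`! * (n == i))%:R.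
Proof.
move=> af a1 f1 leib; elim: i n => [|i IH] n.
  rewrite expr0; elim: n => [|n _]; last by rewrite exprS convM_one f1 mul0r muln0.
  by rewrite expr0 /= rmorph1 scale1r.
rewrite exprS -ltransE ltrans_exp_leibniz // conv_mulrn IH.
case: n => [|n] //=.
by rewrite -mulrnA mulnC mulnA factS eqSS.
Qed.

Lemma convM_ltrans_exp a f : (forall g, ltrans a (f * g) = f * ltrans a g) ->
  forall n g, (f * g) (a ^+ n) = f 1 * g (a ^+ n).
Proof.
move=> fa; elim=> [|n IH] g; first by rewrite expr0 convM_one.
by rewrite exprS -ltransE fa IH.
Qed.

Lemma convM_rtrans_exp a f : (forall g, rtrans a (f * g) = f * rtrans a g) ->
  forall n g, (f * g) (a ^+ n) = f 1 * g (a ^+ n).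
Proof.
move=> fa; elim=> [|n IH] g; first by rewrite expr0 convM_one.
by rewrite exprSr -[LHS]/(rtrans a (f * g) (a ^+ n)) fa IH.
Qed.

End Translations.

(** * Adic sums, exponentials and the T-matrix *)

Lemma adic_sum_support (R : comNzRingType) (W : lmodType (fps R))
    (I J : choiceType) (s : I -> J) (m : J -> I) (u : J -> W) (w : W) :
  cancel s m -> (forall j, j != s (m j) -> u j = 0) ->
  adic_sum u w -> adic_sum (u \o s) w.
Proof.
move=> sK u0 uw n; have [F0 F0P] := uw n.
(* If [F] contains the image of [F0] under [m], then [s] maps [F] onto a set that contains every
   index of [F0] with a nonzero term, so adjoining [F0] to it does not change the sum. *)
exists [fset m j | j in F0]%fset => F /fsubsetP F0F.
have := F0P _ (fsubsetUl F0 [fset s i | i in F]%fset).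
congr (adic_dvd _ (_ - _)).
rewrite [RHS](_ : _ = \sum_(j <- [fset s i | i in F]%fset) u j).
  apply/esym/big_fset_incl => [|j]; first exact: fsubsetUr.
  rewrite inE => /orP[jF0 jF|->//]; apply: u0; apply: contra jF => /eqP ->.
  by apply: in_imfset; apply: F0F; apply: in_imfset.
by rewrite big_imfset //= => i i' _ _ /(can_inj sK).
Qed.

Lemma adic_sum_single (R : comNzRingType) (W : lmodType (fps R))
    (J : choiceType) (u : J -> W) (j0 : J) :
  (forall j, j != j0 -> u j = 0) -> adic_sum u (u j0).
Proof.
move=> u0 n; exists [fset j0]%fset => F; rewrite fsub1set => j0F.
rewrite (big_fsetD1 j0) //= big1_fset ?addr0 ?subrr; first exact: adic_dvd0.
by move=> j; rewrite !inE => /andP[/u0].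
Qed.

Section Series.
Variables (R : realType) (H : hopfType R).

Lemma fcoef_natr n k : fcoef (n%:R : fps R) k = (n * (k == 0%N))%:R.
Proof.
elim: n => [|n IH]; first by rewrite mul0n.
by rewrite mulrS mulSn natrD /= IH.
Qed.

Lemma invfact_mul n : invfact R n * n`!%:R = 1.
Proof.
have nz : n`!%:R != 0 :> R by rewrite Num.Theory.pnatr_eq0 -lt0n fact_gt0.
apply: fpsP => k; rewrite /= big_ord_recl /= subn0 fcoef_natr natrM mulrA mulVf //.
by rewrite mul1r big1 ?addr0 // => i _; rewrite mul0r.
Qed.

(** The coefficients [c ^+ n / n!] tend to 0, so the series converges and [hexp] does not take its
    default value. *)
Lemma hexp_sum (c : fps R) (X : H) : @adic_dvd R (fps R)^o 1 c ->
  adic_sum (fun n : nat => invfact R n *: (c *: X) ^+ n) (hexp (c *: X)).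
Proof.
move=> [v cv]; have -> : c = alpha * v by rewrite cv expr1.
apply: xgetPex => /=.
have -> : (fun n : nat => invfact R n *: ((alpha * v) *: X) ^+ n) =
    (fun n => (invfact R n * (alpha * v) ^+ n) *: X ^+ n).
  by apply/funext => n; rewrite exprZn scalerA.
apply: adic_null_summable; first exact: calg_complete.
move=> n; exists [fset i | i in iota 0 n]%fset => i.
rewrite inE /= mem_iota /= add0n -leqNgt => ni.
apply: (adic_dvd_le ni); exists (invfact R i * v ^+ i).
by rewrite exprMn mulrCA.
Qed.

Lemma ltrans_hexp (A : calgType R) (c : fps R) (X : H) (f : conv H A) :
  @adic_dvd R (fps R)^o 1 c -> ltrans X f = 0 -> ltrans (hexp (c *: X)) f = f.
Proof.
move=> c1 f0; apply: convP => h /=.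
have := adic_sum_linear (rtrans h f) (hexp_sum X c1).
move=> /(adic_sum_unique (calg_complete A).1); apply.
set u := (X in adic_sum X); have -> : f h = u 0%N.
  have i0 : invfact R 0 = 1 by have := invfact_mul 0; rewrite mulr1.
  by rewrite /u /= expr0 i0 scale1r mul1r.
(* Every term of positive degree has [X] as its leftmost factor and is killed by [f]; only the
   constant term remains. *)
apply: adic_sum_single => -[//|n] _.
rewrite /u linearZ /= exprS -!scalerAl linearZ /= -mulrA -ltransE f0.
by rewrite !scaler0.
Qed.

(** For any chosen quotient [y], [alpha] times [f (y * h)] vanishes in [fps R], where multiplication
    by [alpha] is injective. If there is no quotient, [divalpha X] is 0. *)
Lemma ltrans_divalpha (f : dual H) (X : H) :
  ltrans X f = 0 -> ltrans (divalpha X) f = 0.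
Proof.
move=> f0; rewrite /divalpha; case: xgetP => [y _ /= yX|_]; last first.
  by apply: convP => h /=; rewrite mul0r linear0.
apply: convP => h; apply: fpsP => k.
have E : alpha * (f (y * h) : fps R) = 0.
  by have /(congr1 (fun g : dual H => g h)) := f0; rewrite -yX ltransZ.
by have := congr1 (fun p : fps R => fcoef p k.+1) E; rewrite fcoef_alphaM.
Qed.

Lemma dh_series_eq (J : choiceType) (u : J -> dual_tensor H) t :
  dh_sum u t -> dh_series u = t.
Proof.
move=> ut; apply: (xget_unique _ ut) => t' ut'.
by apply: convP => h; apply: adic_sum_unique (calg_complete H).1 (ut' h) (ut h).
Qed.

Lemma universal_T_id (J : choiceType) (e : J -> H) (x : J -> dual H) :
    topological_basis e -> (forall i j, x i (e j) = (i == j)%:R) ->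
  exists t : dual_tensor H,
    dh_sum (fun j => dhpure (x j) (e j)) t /\ forall h, t h = h.
Proof.
move=> eb xe; have idl : linear (@id H) by [].
by exists (Conv idl); split=> //; exact: (dh_expansion eb xe).
Qed.

(** Here [s n] is the index of the [n]-th power in the basis, [m] reads the exponent off an index,
    and [j == s (m j)] tests whether [j] is such an index. As [f ^+ n / n!] is [x (s n)], the
    exponential series is the dual-basis expansion of the endomorphism described. *)
Lemma dexp_sum (J : choiceType) (e : J -> H) (x : J -> dual H)
    (s : nat -> J) (m : J -> nat) (f : dual H) (X : H) :
    topological_basis e -> (forall i j, x i (e j) = (i == j)%:R) ->
    cancel s m -> (forall n j, (f ^+ n) (e j) = (n`! * (j == s n))%:R) ->
  exists t, dh_sum (dexp_term f X) t /\
    forall j, t (e j) = if j == s (m j) then X ^+ m j else 0.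
Proof.
move=> eb xe sK fe.
have fx n : f ^+ n = n`!%:R *: x (s n).
  by apply: (conv_ext eb) => j; rewrite fe /= xe eq_sym natrM.
have [t [ts te]] := dh_exists eb xe (fun j => if j == s (m j) then X ^+ m j else 0).
exists t; split=> // h.
rewrite (_ : (fun n => _) =
  (fun j => dhpure (x j) (if j == s (m j) then X ^+ m j else 0) h) \o s).
  apply: (adic_sum_support sK) (ts h) => j /negbTE jm /=.
  by rewrite jm scaler0.
apply/funext => n /=; rewrite sK eqxx fx /= scalerA.
congr (_ *: _); rewrite -[LHS]/(invfact R n * (n`!%:R * (x (s n) h : fps R))).
by rewrite mulrA invfact_mul mul1r.
Qed.

End Series.

(** * The quantum Poincaré algebra: action of the generators on ordered monomials *)

Section QuantumPoincare.
Variables (R : realType) (U : hopfType R) (M P0 P1 K : U).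
Let e := ordered_monomial M P0 P1 K.
Hypotheses (basis : topological_basis e)
  (Delta_M : Delta M = tens M 1 + tens (hexp (- (alpha *: P1))) M
                       + tens (hexp (- (alpha *: P1)) - 1) P0)
  (Delta_P0 : Delta P0 = tens P0 1 + tens 1 P0)
  (Delta_P1 : Delta P1 = tens P1 1 + tens 1 P1)
  (Delta_K : Delta K = tens K (hexp (alpha *: P1)) + tens 1 K)
  (comm_P0P1 : commutator P0 P1 = 0)
  (comm_MP0 : commutator M P0 = 0)
  (comm_MP1 : commutator M P1 = 0).

Let P0P1 : P0 * P1 = P1 * P0.
Proof. by apply/eqP; rewrite -subr_eq0; apply/eqP. Qed.
Let MP0 : M * P0 = P0 * M.
Proof. by apply/eqP; rewrite -subr_eq0; apply/eqP. Qed.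
Let MP1 : M * P1 = P1 * M.
Proof. by apply/eqP; rewrite -subr_eq0; apply/eqP. Qed.

Lemma mulM_monomial i j k l : M * e (i, j, k, l) = e (i.+1, j, k, l).
Proof. by rewrite /e /= exprS !mulrA. Qed.

Lemma mulP0_monomial i j k l : P0 * e (i, j, k, l) = e (i, j.+1, k, l).
Proof.
have PM : GRing.comm P0 (M ^+ i) by apply: commrX; rewrite /GRing.comm MP0.
by rewrite /e /= exprS !mulrA PM.
Qed.

Lemma mulP1_monomial i j k l : P1 * e (i, j, k, l) = e (i, j, k.+1, l).
Proof.
have PM : GRing.comm P1 (M ^+ i) by apply: commrX; rewrite /GRing.comm MP1.
have PP : GRing.comm P1 (P0 ^+ j) by apply: commrX; rewrite /GRing.comm P0P1.
by rewrite /e /= exprS !mulrA PM -[M ^+ i * P1 * _]mulrA PP !mulrA.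
Qed.

Lemma mul_monomialK i j k l : e (i, j, k, l) * K = e (i, j, k, l.+1).
Proof. by rewrite /e /= exprSr !mulrA. Qed.

Let alpha1 : @adic_dvd R (fps R)^o 1 alpha.
Proof. by exists 1; rewrite -[RHS]/(_ * _) mulr1 expr1. Qed.

(** * Leibniz rules of the generators and evaluation on monomials *)

Section Values.
Variable A : calgType R.
Implicit Types f g : conv U A.

Lemma ltrans_expP1 f : ltrans P1 f = 0 -> ltrans (hexp (alpha *: P1)) f = f.
Proof. exact: ltrans_hexp. Qed.

Lemma ltrans_expNP1 f :
  ltrans P1 f = 0 -> ltrans (hexp (- (alpha *: P1))) f = f.
Proof. by rewrite -scaleNr; apply: ltrans_hexp; apply: adic_dvdN. Qed.

Lemma ltransM_M f g : ltrans M (f * g) =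
  ltrans M f * g + ltrans (hexp (- (alpha *: P1))) f * ltrans M g
  + ltrans (hexp (- (alpha *: P1)) - 1) f * ltrans P0 g.
Proof.
apply: convP => h; rewrite ltransE convME rmorphM /= Delta_M !mulrDl !linearD /=.
by rewrite !lift_tensMl !ltrans1.
Qed.

Lemma ltransM_M_leibniz f g : ltrans P1 f = 0 ->
  ltrans M (f * g) = ltrans M f * g + f * ltrans M g.
Proof.
move=> f1; rewrite ltransM_M ltransD ltransN ltrans1 ltrans_expNP1 //.
by rewrite subrr mul0r addr0.
Qed.

(** Counterpart of [ltransM_M_leibniz] for left factors that [P1] may not kill: the twisted terms
    vanish through [g] instead. *)
Lemma ltransM_M_left f g : ltrans M g = 0 -> ltrans P0 g = 0 ->
  ltrans M (f * g) = ltrans M f * g.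
Proof. by move=> gM g0; rewrite ltransM_M gM g0 !mulr0 !addr0. Qed.

Lemma ltransM_K f g : ltrans P1 g = 0 ->
  ltrans K (f * g) = ltrans K f * g + f * ltrans K g.
Proof.
move=> g1; apply: convP => h.
rewrite ltransE convME rmorphM /= Delta_K mulrDl linearD /=.
by rewrite !lift_tensMl !ltrans1 ltrans_expP1.
Qed.

Lemma rtransM_K f g : rtrans K f = 0 -> rtrans K (f * g) = f * rtrans K g.
Proof.
move=> fK; apply: convP => h.
rewrite -[LHS]/((f * g) (h * K)) convME rmorphM /= Delta_K mulrDr linearD /=.
(* The first term of [Delta K] gives a convolution product with left factor [rtrans K f = 0],
   whatever the exponential does to [g]. *)
rewrite !lift_tensMr rtrans1 fK -[RHS]add0r; congr (_ + _).
by rewrite -convME mul0r.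
Qed.

Lemma ltransM_P0 f g : ltrans P0 (f * g) = ltrans P0 f * g + f * ltrans P0 g.
Proof. exact: ltrans_primitiveM. Qed.

Lemma ltransM_P1 f g : ltrans P1 (f * g) = ltrans P1 f * g + f * ltrans P1 g.
Proof. exact: ltrans_primitiveM. Qed.

Lemma ltrans_one a :
  ltrans a (1 * 1) = ltrans a 1 * 1 + 1 * ltrans a 1 :> conv U A ->
  ltrans a 1 = 0 :> conv U A.
Proof.
by rewrite !mul1r mulr1 -[LHS]addr0 => /addrI.
Qed.

Lemma ltrans_one_P0 : ltrans P0 1 = 0 :> conv U A.
Proof. exact/ltrans_one/ltransM_P0. Qed.

Lemma ltrans_one_P1 : ltrans P1 1 = 0 :> conv U A.
Proof. exact/ltrans_one/ltransM_P1. Qed.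

Lemma ltrans_one_M : ltrans M 1 = 0 :> conv U A.
Proof. exact/ltrans_one/ltransM_M_leibniz/ltrans_one_P1. Qed.

Lemma ltrans_one_K : ltrans K 1 = 0 :> conv U A.
Proof. exact/ltrans_one/ltransM_K/ltrans_one_P1. Qed.

Lemma ltrans_eq a f g : (forall i j k l,
  f (a * e (i, j, k, l)) = g (e (i, j, k, l))) -> ltrans a f = g.
Proof. by move=> E; apply: (conv_ext basis) => -[[[i j] k] l]; apply: E. Qed.

Lemma rtrans_eq a f g : (forall i j k l,
  f (e (i, j, k, l) * a) = g (e (i, j, k, l))) -> rtrans a f = g.
Proof. by move=> E; apply: (conv_ext basis) => -[[[i j] k] l]; apply: E. Qed.

Lemma ltrans_M_eq0 f :
  (forall i j k l, f (e (i.+1, j, k, l)) = 0) -> ltrans M f = 0.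
Proof. by move=> f0; apply: ltrans_eq => i j k l; rewrite mulM_monomial. Qed.

Lemma ltrans_P0_eq0 f :
  (forall i j k l, f (e (i, j.+1, k, l)) = 0) -> ltrans P0 f = 0.
Proof. by move=> f0; apply: ltrans_eq => i j k l; rewrite mulP0_monomial. Qed.

Lemma ltrans_P1_eq0 f :
  (forall i j k l, f (e (i, j, k.+1, l)) = 0) -> ltrans P1 f = 0.
Proof. by move=> f0; apply: ltrans_eq => i j k l; rewrite mulP1_monomial. Qed.

Lemma rtrans_K_eq0 f :
  (forall i j k l, f (e (i, j, k, l.+1)) = 0) -> rtrans K f = 0.
Proof. by move=> f0; apply: rtrans_eq => i j k l; rewrite mul_monomialK. Qed.

Lemma ltrans_M0_monomial f i j k l :
  ltrans M f = 0 -> f (e (i, j, k, l)) = if i is 0 then f (e (0, j, k, l)%N) else 0.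
Proof. by case: i => // i f0; rewrite -mulM_monomial -ltransE f0. Qed.

Lemma ltrans_P00_monomial f i j k l :
  ltrans P0 f = 0 -> f (e (i, j, k, l)) = if j is 0 then f (e (i, 0, k, l)%N) else 0.
Proof. by case: j => // j f0; rewrite -mulP0_monomial -ltransE f0. Qed.

Lemma ltrans_P10_monomial f i j k l :
  ltrans P1 f = 0 -> f (e (i, j, k, l)) = if k is 0 then f (e (i, j, 0, l)%N) else 0.
Proof. by case: k => // k f0; rewrite -mulP1_monomial -ltransE f0. Qed.

Lemma rtrans_K0_monomial f i j k l :
  rtrans K f = 0 -> f (e (i, j, k, l)) = if l is 0 then f (e (i, j, k, 0)%N) else 0.
Proof. by case: l => // l f0; rewrite -mul_monomialK -[LHS]/(rtrans K f _) f0. Qed.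

(** The unit is the counit followed by scalars. Its values are forced by the coproducts, through the
    fact that every generator kills 1. *)
Lemma conv_one_monomial i j k l :
  (1 : conv U A) (e (i, j, k, l)) = ((i, j, k, l) == (0, 0, 0, 0)%N)%:R.
Proof.
rewrite (ltrans_M0_monomial _ _ _ _ ltrans_one_M) (ltrans_P00_monomial _ _ _ _ ltrans_one_P0).
rewrite (ltrans_P10_monomial _ _ _ _ ltrans_one_P1); move: i j k l => [|i] [|j] [|k] [|l] //.
  by rewrite /e /= !expr0 !mulr1 rmorph1 scale1r.
by rewrite /e /= !expr0 !mul1r exprS -[LHS]/(ltrans K 1 _) ltrans_one_K.
Qed.

Lemma rtrans_one_K : rtrans K 1 = 0 :> conv U A.
Proof. by apply: rtrans_K_eq0 => i j k l; rewrite conv_one_monomial !xpair_eqE andbF. Qed.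

(** Generators stripped off on the left all land on [f], since they kill [g]; each [K] stripped off
    on the right lands on [g]. The condition on [f] survives the induction because left and right
    translations commute. *)
Lemma conv_monomial_K f g i j k l : rtrans K f = 0 ->
    ltrans M g = 0 -> ltrans P0 g = 0 -> ltrans P1 g = 0 ->
  (f * g) (e (i, j, k, l)) = f (e (i, j, k, 0%N)) * g (K ^+ l).
Proof.
move=> fK gM g0 g1; elim: i f fK => [|i IH] f fK.
  elim: j f fK => [|j IH] f fK.
    elim: k f fK => [|k IH] f fK.
      rewrite /e /= !expr0 !mul1r; apply: convM_rtrans_exp => h; exact: rtransM_K.
    rewrite -!mulP1_monomial -ltransE ltransM_P1 g1 mulr0 addr0 IH //.
    by rewrite -ltrans_rtrans fK ltrans0_r.
  rewrite -!mulP0_monomial -ltransE ltransM_P0 g0 mulr0 addr0 IH //.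
  by rewrite -ltrans_rtrans fK ltrans0_r.
rewrite -!mulM_monomial -ltransE ltransM_M_left // IH //.
by rewrite -ltrans_rtrans fK ltrans0_r.
Qed.

(** The induction replaces [f] by its translates under [M] and [P0]; these are still killed by [P1],
    which commutes with both. *)
Lemma conv_monomial_P1 f g i j k :
    ltrans P1 f = 0 -> ltrans M g = 0 -> ltrans P0 g = 0 ->
  (f * g) (e (i, j, k, 0%N)) = f (e (i, j, 0%N, 0%N)) * g (P1 ^+ k).
Proof.
move=> f1 gM g0; elim: i f f1 => [|i IH] f f1.
  elim: j f f1 => [|j IH] f f1.
    rewrite /e /= !expr0 !mul1r !mulr1; apply: convM_ltrans_exp => h.
    by rewrite ltransM_P1 f1 mul0r add0r.
  rewrite -!mulP0_monomial -ltransE ltransM_P0 g0 mulr0 addr0 IH //.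
  exact: ltrans_comm0.
rewrite -!mulM_monomial -ltransE ltransM_M_left // IH //.
exact: ltrans_comm0.
Qed.

Lemma conv_monomial_P0 f g i j :
    ltrans P0 f = 0 -> ltrans P1 f = 0 -> ltrans M g = 0 ->
  (f * g) (e (i, j, 0%N, 0%N)) = f (M ^+ i) * g (P0 ^+ j).
Proof.
move=> f0 f1 gM; elim: i f f0 f1 => [|i IH] f f0 f1.
  rewrite /e /= !expr0 !mul1r !mulr1; apply: convM_ltrans_exp => h.
  by rewrite ltransM_P0 f0 mul0r add0r.
rewrite -!mulM_monomial -ltransE ltransM_M_leibniz // gM mulr0 addr0 exprS.
by rewrite -ltransE; apply: IH; apply: ltrans_comm0.
Qed.

Lemma conv_monomial (fM f0 f1 fK : conv U A) i j k l :
    ltrans P0 fM = 0 -> ltrans P1 fM = 0 -> rtrans K fM = 0 ->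
    ltrans M f0 = 0 -> ltrans P1 f0 = 0 -> rtrans K f0 = 0 ->
    ltrans M f1 = 0 -> ltrans P0 f1 = 0 -> rtrans K f1 = 0 ->
    ltrans M fK = 0 -> ltrans P0 fK = 0 -> ltrans P1 fK = 0 ->
  (fM * f0 * f1 * fK) (e (i, j, k, l)) =
  fM (M ^+ i) * f0 (P0 ^+ j) * f1 (P1 ^+ k) * fK (K ^+ l).
Proof.
move=> fM_P0 fM_P1 fM_K f0_M f0_P1 f0_K f1_M f1_P0 f1_K fK_M fK_P0 fK_P1.
(* The factors are split off from the right: [fK], then [f1], then [f0]. The first side goal is that
   [rtrans K] kills the product of the other three. *)
rewrite conv_monomial_K //; last first.
  by rewrite rtransM_K ?f1_K ?mulr0 // rtransM_K ?f0_K ?mulr0.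
rewrite conv_monomial_P1 ?conv_monomial_P0 //.
by rewrite ltransM_P1 fM_P1 f0_P1 mul0r mulr0 addr0.
Qed.

(** * Powers of a coordinate *)

Section Powers.
Variable f : conv U A.

Lemma ltrans_expr_P0 n : ltrans P0 f = 0 -> ltrans P0 (f ^+ n) = 0.
Proof.
move=> f0; elim: n => [|n IH]; first exact: ltrans_one_P0.
by rewrite exprS ltransM_P0 f0 IH mul0r mulr0 addr0.
Qed.

Lemma ltrans_expr_P1 n : ltrans P1 f = 0 -> ltrans P1 (f ^+ n) = 0.
Proof.
move=> f0; elim: n => [|n IH]; first exact: ltrans_one_P1.
by rewrite exprS ltransM_P1 f0 IH mul0r mulr0 addr0.
Qed.

(** Two alternatives are offered because [a0] is not killed by [P0] and [a1] is not killed by [P1];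
    each selects one of the two product rules for [M]. *)
Lemma ltrans_expr_M n :
  ltrans M f = 0 -> ltrans P0 f = 0 \/ ltrans P1 f = 0 -> ltrans M (f ^+ n) = 0.
Proof.
move=> fM fP; elim: n => [|n IH]; first exact: ltrans_one_M.
case: fP => fP; last by rewrite exprS ltransM_M_leibniz // fM IH mul0r mulr0 addr0.
by rewrite exprS ltransM_M_left ?ltrans_expr_P0 // fM mul0r.
Qed.

Lemma rtrans_expr_K n : rtrans K f = 0 -> rtrans K (f ^+ n) = 0.
Proof.
move=> fK; elim: n => [|n IH]; first exact: rtrans_one_K.
by rewrite exprS rtransM_K // IH mulr0.
Qed.

(** Whatever kills [f] kills its powers, which therefore vanish on monomials involving another
    generator; on powers of [M], [conv_exp_dual] applies. *)
Lemma expr_dual_M n i j k l : ltrans M f = 1 -> f 1 = 0 ->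
    ltrans P0 f = 0 -> ltrans P1 f = 0 -> rtrans K f = 0 ->
  (f ^+ n) (e (i, j, k, l)) = (n`! * ((i, j, k, l) == (n, 0, 0, 0)%N))%:R.
Proof.
move=> fM f1 fP0 fP1 fK.
rewrite (ltrans_P00_monomial _ _ _ _ (ltrans_expr_P0 n fP0)).
rewrite (ltrans_P10_monomial _ _ _ _ (ltrans_expr_P1 n fP1)).
rewrite (rtrans_K0_monomial _ _ _ _ (rtrans_expr_K n fK)) !xpair_eqE.
case: j k l => [|j] [|k] [|l]; rewrite ?(andbF, andbT, muln0) //.
rewrite /e /= !expr0 !mulr1 eq_sym; apply: (conv_exp_dual _ _ fM ltrans_one_M) => //.
by move=> m; apply: ltransM_M_leibniz.
Qed.

Lemma expr_dual_P0 n i j k l : ltrans P0 f = 1 -> f 1 = 0 ->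
    ltrans M f = 0 -> ltrans P1 f = 0 -> rtrans K f = 0 ->
  (f ^+ n) (e (i, j, k, l)) = (n`! * ((i, j, k, l) == (0, n, 0, 0)%N))%:R.
Proof.
move=> fP0 f1 fM fP1 fK.
rewrite (ltrans_M0_monomial _ _ _ _ (ltrans_expr_M n fM (or_intror fP1))).
rewrite (ltrans_P10_monomial _ _ _ _ (ltrans_expr_P1 n fP1)).
rewrite (rtrans_K0_monomial _ _ _ _ (rtrans_expr_K n fK)) !xpair_eqE.
case: i k l => [|i] [|k] [|l]; rewrite ?(andbF, andbT, muln0) //.
rewrite /e /= !expr0 !mulr1 mul1r eq_sym.
by apply: (conv_exp_dual _ _ fP0 ltrans_one_P0) => // m; apply: ltransM_P0.
Qed.

Lemma expr_dual_P1 n i j k l : ltrans P1 f = 1 -> f 1 = 0 ->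
    ltrans M f = 0 -> ltrans P0 f = 0 -> rtrans K f = 0 ->
  (f ^+ n) (e (i, j, k, l)) = (n`! * ((i, j, k, l) == (0, 0, n, 0)%N))%:R.
Proof.
move=> fP1 f1 fM fP0 fK.
rewrite (ltrans_M0_monomial _ _ _ _ (ltrans_expr_M n fM (or_introl fP0))).
rewrite (ltrans_P00_monomial _ _ _ _ (ltrans_expr_P0 n fP0)).
rewrite (rtrans_K0_monomial _ _ _ _ (rtrans_expr_K n fK)) !xpair_eqE.
case: i j l => [|i] [|j] [|l]; rewrite ?(andbF, andbT, muln0) //.
rewrite /e /= !expr0 !mulr1 !mul1r eq_sym.
by apply: (conv_exp_dual _ _ fP1 ltrans_one_P1) => // m; apply: ltransM_P1.
Qed.

Lemma expr_dual_K n i j k l : ltrans K f = 1 -> f 1 = 0 ->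
    ltrans M f = 0 -> ltrans P0 f = 0 -> ltrans P1 f = 0 ->
  (f ^+ n) (e (i, j, k, l)) = (n`! * ((i, j, k, l) == (0, 0, 0, n)%N))%:R.
Proof.
move=> fK f1 fM fP0 fP1.
rewrite (ltrans_M0_monomial _ _ _ _ (ltrans_expr_M n fM (or_introl fP0))).
rewrite (ltrans_P00_monomial _ _ _ _ (ltrans_expr_P0 n fP0)).
rewrite (ltrans_P10_monomial _ _ _ _ (ltrans_expr_P1 n fP1)) !xpair_eqE.
case: i j k => [|i] [|j] [|k]; rewrite ?(andbF, andbT, muln0) //.
rewrite /e /= !expr0 !mul1r eq_sym.
apply: (conv_exp_dual _ _ fK ltrans_one_K) => // m; apply: ltransM_K.
exact: ltrans_expr_P1.
Qed.

End Powers.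
End Values.

(** * The coordinate dual to [K] and the commutation relations *)

Section Chi.
Hypotheses
  (comm_KP0 : commutator K P0 = divalpha (hexp (alpha *: P1) - 1))
  (comm_KP1 : commutator K P1 = (M + P0) * hexp (alpha *: P1))
  (comm_KM : commutator K M =
     - (divalpha (hcosh (alpha *: P1) - 1)
        + (alpha * fpsC 2^-1) *: ((M + P0) ^+ 2 * hexp (alpha *: P1)))).

(* The right ideal [{X | f (X h) = 0 for all h}] contains [M], [P0], [P1] and
   their commutators with [K], so these generators can be moved past [K]. *)
Lemma ltrans_K_dual (f : dual U) :
    ltrans M f = 0 -> ltrans P0 f = 0 -> ltrans P1 f = 0 ->
    (forall l, f (K ^+ l) = (l == 1%N)%:R) ->
  ltrans K f = 1.
Proof.
move=> fM fP0 fP1 fK.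
have fE : ltrans (hexp (alpha *: P1)) f = f by apply: ltrans_expP1.
have fNE : ltrans (hexp (- (alpha *: P1))) f = f by apply: ltrans_expNP1.
have fN : ltrans (M + P0) f = 0 by rewrite ltransD fM fP0 addr0.
(* [X] acting on [ltrans K f] is the translation of [f] by [K * X], which is the commutator plus
   [X * K]; both summands kill [f]. *)
have KX X : ltrans X f = 0 -> ltrans (commutator K X) f = 0 ->
    ltrans X (ltrans K f) = 0.
  move=> fX; rewrite ltransD ltransN -!ltransM => /eqP.
  by rewrite [ltrans (X * K) f]ltransM fX ltrans0_r subr0 => /eqP.
have f_cosh : ltrans (hcosh (alpha *: P1)) f = f.
  rewrite /hcosh ltransZ ltransD fE fNE.
  apply: convP => h /=.
  (* As [2! = 2], the constant [fpsC 2^-1] is [invfact R 2], and [invfact_mul] cancels it against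
     the doubled value. *)
  rewrite -[LHS]/(invfact R 2 * ((f h : fps R) + f h)).
  by rewrite -mulr2n -[X in _ * X]mulr_natl mulrA invfact_mul mul1r.
have KM : ltrans M (ltrans K f) = 0.
  apply: KX => //; rewrite comm_KM ltransN ltransD ltransZ ltrans_divalpha.
    by rewrite expr2 -mulrA ltransM fN ltrans0_r scaler0 addr0 oppr0.
  by rewrite ltransD ltransN ltrans1 f_cosh subrr.
have KP0 : ltrans P0 (ltrans K f) = 0.
  apply: KX => //; rewrite comm_KP0 ltrans_divalpha //.
  by rewrite ltransD ltransN ltrans1 fE subrr.
have KP1 : ltrans P1 (ltrans K f) = 0.
  by apply: KX => //; rewrite comm_KP1 ltransM fN ltrans0_r.
apply: (conv_ext basis) => -[[[i j] k] l]; rewrite conv_one_monomial.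
rewrite (ltrans_M0_monomial _ _ _ _ KM) (ltrans_P00_monomial _ _ _ _ KP0).
rewrite (ltrans_P10_monomial _ _ _ _ KP1); case: i j k => [|i] [|j] [|k] //.
by rewrite ltransE /e /= !expr0 !mul1r -exprS fK.
Qed.

End Chi.
End QuantumPoincare.

(** * The product of the four exponentials *)

Theorem proposition4p3 (R : realType) (U : hopfType R) (M P0 P1 K : U)
  (basis : topological_basis (ordered_monomial M P0 P1 K))
  (Delta_M : Delta M = tens M 1 + tens (hexp (- (alpha *: P1))) M
                       + tens (hexp (- (alpha *: P1)) - 1) P0)
  (Delta_P0 : Delta P0 = tens P0 1 + tens 1 P0)
  (Delta_P1 : Delta P1 = tens P1 1 + tens 1 P1)
  (Delta_K : Delta K = tens K (hexp (alpha *: P1)) + tens 1 K)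
  (comm_P0P1 : commutator P0 P1 = 0)
  (comm_MP0 : commutator M P0 = 0)
  (comm_MP1 : commutator M P1 = 0)
  (comm_KP0 : commutator K P0 = divalpha (hexp (alpha *: P1) - 1))
  (comm_KP1 : commutator K P1 = (M + P0) * hexp (alpha *: P1))
  (comm_KM : commutator K M =
     - (divalpha (hcosh (alpha *: P1) - 1)
        + (alpha * fpsC 2^-1) *: ((M + P0) ^+ 2 * hexp (alpha *: P1))))
  (x : nat * nat * nat * nat -> dual U)
  (x_dual : forall mu nu : nat * nat * nat * nat,
     x mu (ordered_monomial M P0 P1 K nu) = (mu == nu)%:R) :
  let theta := x (1, 0, 0, 0)%N in
  let a0 := x (0, 1, 0, 0)%N in
  let a1 := x (0, 0, 1, 0)%N in
  let chi := x (0, 0, 0, 1)%N in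
  [/\ dh_summable
        (fun mu => dhpure (x mu) (ordered_monomial M P0 P1 K mu)),
      [/\ dh_summable (dexp_term theta M), dh_summable (dexp_term a0 P0),
          dh_summable (dexp_term a1 P1) & dh_summable (dexp_term chi K)]
    & universal_T x (ordered_monomial M P0 P1 K) =
        dexp theta M * dexp a0 P0 * dexp a1 P1 * dexp chi K].
Proof.
move=> theta a0 a1 chi.
have dual1 mu : mu != (0, 0, 0, 0)%N -> x mu 1 = 0.
  move=> /negbTE mu0; have <- : ordered_monomial M P0 P1 K (0, 0, 0, 0)%N = 1.
    by rewrite /= !expr0 !mulr1.
  by rewrite x_dual mu0.
have dualS : (ltrans M theta = 1) * (ltrans P0 a0 = 1) * (ltrans P1 a1 = 1).
  do !split; apply: (ltrans_eq basis) => i j k l;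
    rewrite ?mulM_monomial ?mulP0_monomial ?mulP1_monomial // x_dual;
    by rewrite conv_one_monomial // eq_sym !xpair_eqE ?eqSS.
have dM : (ltrans M a0 = 0) * (ltrans M a1 = 0) * (ltrans M chi = 0).
  by do !split; apply: (ltrans_M_eq0 basis) => i j k l; rewrite x_dual.
have dP0 : (ltrans P0 theta = 0) * (ltrans P0 a1 = 0) * (ltrans P0 chi = 0).
  do !split; apply: (ltrans_P0_eq0 basis) => // i j k l;
    by rewrite x_dual !xpair_eqE ?andbF.
have dP1 : (ltrans P1 theta = 0) * (ltrans P1 a0 = 0) * (ltrans P1 chi = 0).
  do !split; apply: (ltrans_P1_eq0 basis) => // i j k l;
    by rewrite x_dual !xpair_eqE ?andbF.
have dK : (rtrans K theta = 0) * (rtrans K a0 = 0) * (rtrans K a1 = 0).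
  do !split; apply: (rtrans_K_eq0 basis) => i j k l;
    by rewrite x_dual !xpair_eqE ?andbF.
(* Left multiplication by [K] does not simply shift a monomial, so here, unlike in [dualS], the
   commutators with [K] enter. *)
have chiS : ltrans K chi = 1.
  apply: (ltrans_K_dual basis) => //; rewrite ?dM ?dP0 ?dP1 // => l.
  have := x_dual (0, 0, 0, 1)%N (0, 0, 0, l)%N.
  by rewrite /= !expr0 !mul1r => ->; rewrite eq_sym.
have [T [sumT idT]] := universal_T_id basis x_dual.
(* The test on [mu] singles out the pure powers of [M]; the next three exponentials are treated
   alike. *)
have [tM [sumM tME]] : exists t, dh_sum (dexp_term theta M) t /\ forall mu,
    t (ordered_monomial M P0 P1 K mu) =
    if mu == (mu.1.1.1, 0, 0, 0)%N then M ^+ mu.1.1.1 else 0.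
  apply: (@dexp_sum _ _ _ _ x (fun n => (n, 0, 0, 0)%N) (fun mu => mu.1.1.1)) => //.
  move=> n [[[i j] k] l].
  by apply: expr_dual_M => //; rewrite ?dualS ?dP0 ?dP1 ?dK ?dual1.
have [t0 [sum0 t0E]] : exists t, dh_sum (dexp_term a0 P0) t /\ forall mu,
    t (ordered_monomial M P0 P1 K mu) =
    if mu == (0, mu.1.1.2, 0, 0)%N then P0 ^+ mu.1.1.2 else 0.
  apply: (@dexp_sum _ _ _ _ x (fun n => (0, n, 0, 0)%N) (fun mu => mu.1.1.2)) => //.
  move=> n [[[i j] k] l].
  by apply: expr_dual_P0 => //; rewrite ?dualS ?dM ?dP1 ?dK ?dual1.
have [t1 [sum1 t1E]] : exists t, dh_sum (dexp_term a1 P1) t /\ forall mu,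
    t (ordered_monomial M P0 P1 K mu) =
    if mu == (0, 0, mu.1.2, 0)%N then P1 ^+ mu.1.2 else 0.
  apply: (@dexp_sum _ _ _ _ x (fun n => (0, 0, n, 0)%N) (fun mu => mu.1.2)) => //.
  move=> n [[[i j] k] l].
  by apply: expr_dual_P1 => //; rewrite ?dualS ?dM ?dP0 ?dK ?dual1.
have [tK [sumK tKE]] : exists t, dh_sum (dexp_term chi K) t /\ forall mu,
    t (ordered_monomial M P0 P1 K mu) =
    if mu == (0, 0, 0, mu.2)%N then K ^+ mu.2 else 0.
  apply: (@dexp_sum _ _ _ _ x (fun n => (0, 0, 0, n)%N) (fun mu => mu.2)) => //.
  move=> n [[[i j] k] l].
  by apply: expr_dual_K => //; rewrite ?chiS ?dM ?dP0 ?dP1 ?dual1.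
split; [by exists T | by split; [exists tM | exists t0 | exists t1 | exists tK] |].
rewrite /universal_T /dexp (dh_series_eq sumT) (dh_series_eq sumM).
rewrite (dh_series_eq sum0) (dh_series_eq sum1) (dh_series_eq sumK).
apply: (conv_ext basis) => -[[[i j] k] l]; rewrite idT.
(* Each exponential vanishes on every monomial that is not a pure power of its own generator, which
   gives all twelve annihilation conditions. *)
rewrite conv_monomial //;
  try by [apply: (ltrans_M_eq0 basis) => // ? ? ? ?;
          rewrite ?t0E ?t1E ?tKE !xpair_eqE ?andbF
         |apply: (ltrans_P0_eq0 basis) => // ? ? ? ?;
          rewrite ?tME ?t1E ?tKE !xpair_eqE ?andbF
         |apply: (ltrans_P1_eq0 basis) => // ? ? ? ?;
          rewrite ?tME ?t0E ?tKE !xpair_eqE ?andbF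
         |apply: (rtrans_K_eq0 basis) => ? ? ? ?;
          rewrite ?tME ?t0E ?t1E !xpair_eqE ?andbF].
(* On pure powers each exponential returns its argument, so the four values multiply to the ordered
   monomial. *)
have := tME (i, 0, 0, 0)%N; rewrite /= !expr0 !mulr1 eqxx => ->.
have := t0E (0, j, 0, 0)%N; rewrite /= !expr0 !mulr1 mul1r eqxx => ->.
have := t1E (0, 0, k, 0)%N; rewrite /= !expr0 !mulr1 !mul1r eqxx => ->.
by have := tKE (0, 0, 0, l)%N; rewrite /= !expr0 !mul1r eqxx => ->.
Qed.
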